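(* Let $\tau_0,\tau_1>0$, $n\ge1$, $\lambda_i>0$ with $\sum_{i=1}^n\lambda_i=1$, $a_i>0$, $\mu_i=\mathcal N(m_i,\Sigma_i)\in\mathcal G_d^1$. Let $\nu^k\in\mathcal G_d^1$, let $\nu^{k+1}=T(\nu^k)$ be obtained from $\nu^k$ by the moment update $T$ (see context), and let $b^k=\mathsf Z(\nu^k)^{1/\theta}$. Then $$\Phi(\nu^k)-\Phi(\nu^{k+1})\ge\tau_1b^k\,\mathrm{KL}(\nu^{k+1}\mid\nu^k)\ge0.$$ The descent is strict whenever $\nu^{k+1}\ne\nu^k$; equivalently, $\Phi(\nu^{k+1})=\Phi(\nu^k)$ if and only if $\nu^{k+1}=\nu^k$.
   Context: $\mathbb S_{++}^d$: real symmetric positive-definite $d\times d$ matrices; $\mathcal G_d^1=\{\mathcal N(m,\Sigma):m\in\mathbb R^d,\Sigma\in\mathbb S_{++}^d\}$. Put $s=\tau_0+\tau_1$, $\theta=\tau_0/s$. For $\mu,\nu\in\mathcal G_d^1$, $$\mathsf A(\mu,\nu)=\inf_{p,q\in\mathcal P(\mathbb R^d)}\{W_2^2(p,q)+\tau_0\mathrm{KL}(p\mid\mu)+\tau_1\mathrm{KL}(q\mid\nu)\},$$ with $\mathrm{KL}$ the relative entropy and $W_2^2(p,q)\in[0,\infty]$ the squared quadratic Wasserstein cost. It is known that the minimizer $(p,q)$ is unique and that $p,q$ are nondegenerate Gaussians. Set $A_i(\nu)=\mathsf A(\mu_i,\nu)$, let $q_i(\nu)=\mathcal N(v_i,Q_i)$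 be the second component of the minimizer for $(\mu_i,\nu)$, $\mathsf Z(\nu)=\sum_i\lambda_ia_i^\theta e^{-A_i(\nu)/s}$, $\omega_i(\nu)=\lambda_ia_i^\theta e^{-A_i(\nu)/s}/\mathsf Z(\nu)$, $\bar a=\sum_i\lambda_ia_i$, and $\Phi(\nu)=\tau_0(\bar a-\mathsf Z(\nu)^{1/\theta})$. (Equivalently, $\Phi(\nu)=\inf_{b>0}\sum_i\lambda_i\mathsf U_{\tau_0,\tau_1}(a_i\mu_i,b\nu)$, where $\mathsf U_{\tau_0,\tau_1}(\alpha,\beta)=\inf_\gamma\{\int\|x-y\|^2d\gamma+\tau_0\mathrm{KL}(\gamma_0\mid\alpha)+\tau_1\mathrm{KL}(\gamma_1\mid\beta)\}$ over finite nonnegative measures $\gamma$ on $\mathbb R^d\times\mathbb R^d$ with marginals $\gamma_0,\gamma_1$, with $\mathrm{KL}(\rho\mid\eta)=\int(r\log r-r+1)d\eta$, $r=d\rho/d\eta$, for finite measures.) The moment update is $T(\nu)=\mathcal N(m^+,\Sigma^+)$ with $m^+=\sum_i\omega_i(\nu)v_i$ and $\Sigma^+=\sum_i\omega_i(\nu)[Q_i+(v_i-m^+)(v_i-m^+)^\top]$. *)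

(* Defs.v *)
From HB Require Import structures.
From mathcomp Require Import all_boot all_order all_algebra.
From mathcomp Require Import all_classical all_reals all_analysis.

Set Implicit Arguments.
Unset Strict Implicit.
Unset Printing Implicit Defensive.

Import Order.TTheory GRing.Theory Num.Theory.
Import numFieldNormedType.Exports.

Local Open Scope classical_set_scope.
Local Open Scope charge_scope.
Local Open Scope ring_scope.

(* A mathcomp measure is a function on all sets, constrained only on the
   measurable ones, so Leibniz equality would be too fine. *)
Definition meas_eq dT (T : measurableType dT) (R : realType)
    (P Q : set T -> \bar R) : Prop :=
  forall A, measurable A -> P A = Q A.

(* Points of R^d are tuples, which carry the product sigma-algebra; [colv] below
   turns them into column vectors when matrix algebra is needed. *)
Fixpoint lebesgueRn (R : realType) (d : nat) : set (d.-tuple R) -> \bar R :=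
  match d with
  | 0 => \d_([tuple] : 0.-tuple R)
  | d'.+1 =>
      pushforward (@lebesgue_measure R \x @lebesgueRn R d')%E
        (fun z : R * d'.-tuple R => [tuple of z.1 :: z.2])
  end.
Arguments lebesgueRn {R} d A : rename.

Section gaussian.
Context {R : realType} {d : nat}.

Definition colv (x : d.-tuple R) : 'cV[R]_d := \col_i tnth x i.

Definition sym_posdef (S : 'M[R]_d) : Prop :=
  S^T = S /\ forall x : 'cV[R]_d, x != 0 -> 0 < (x^T *m S *m x) 0 0.

Definition gaussian_pdf (m : 'cV[R]_d) (S : 'M[R]_d) (x : d.-tuple R) : R :=
  (Num.sqrt ((2 * pi) ^+ d * \det S))^-1 *
  expR (- ((colv x - m)^T *m invmx S *m (colv x - m)) 0 0 / 2).

(* P is the nondegenerate Gaussian N(m, S) *)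
Definition is_gaussian (P : probability (d.-tuple R) R)
    (m : 'cV[R]_d) (S : 'M[R]_d) : Prop :=
  sym_posdef S /\
  meas_eq P (fun A => \int[lebesgueRn d]_(x in A) (gaussian_pdf m S x)%:E)%E.

Definition nondeg_gaussian (P : probability (d.-tuple R) R) : Prop :=
  exists m S, is_gaussian P m S.

End gaussian.

(* KL(p | q) = \int (r log r - r + 1) dq with r = dp/dq, and +oo unless p << q;
   [ln 0 = 0] gives the convention 0 log 0 = 0. *)
Definition KL dT (T : measurableType dT) (R : realType)
    (p q : probability T R) : \bar R :=
  if `[< p `<< q >] then
    (\int[q]_x (let r := fine ('d (charge_of_finite_measure p) '/d q x)%R in
                (r * ln r - r + 1)%:E))%E
  else +oo%E.

Section transport.
Context {R : realType} {d : nat}.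
Local Notation E := (d.-tuple R).
Local Notation prob := (probability (d.-tuple R) R).

Definition sqdist (x y : E) : R := \sum_(i < d) (tnth x i - tnth y i) ^+ 2.

Definition coupling (p q : prob) (g : probability (E * E)%type R) : Prop :=
  meas_eq (pushforward g fst) p /\ meas_eq (pushforward g snd) q.

Definition W2sq (p q : prob) : \bar R :=
  ereal_inf [set (\int[g]_z (sqdist z.1 z.2)%:E)%E | g in coupling p q].

Definition A_objective (tau0 tau1 : R) (mu nu p q : prob) : \bar R :=
  (W2sq p q + tau0%:E * KL p mu + tau1%:E * KL q nu)%E.

Definition A_value (tau0 tau1 : R) (mu nu : prob) : \bar R :=
  ereal_inf [set A_objective tau0 tau1 mu nu pq.1 pq.2
            | pq in [set: prob * prob]].

Definition A_minimizer (tau0 tau1 : R) (mu nu p q : prob) : Prop :=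
  A_objective tau0 tau1 mu nu p q = A_value tau0 tau1 mu nu.

End transport.

Section barycenter.
Context {R : realType} {d n : nat}.
Local Notation prob := (probability (d.-tuple R) R).
Variables (tau0 tau1 : R) (lambda a : 'I_n -> R) (mu : 'I_n -> prob).

Definition theta : R := tau0 / (tau0 + tau1).

(* lambda_i a_i^theta exp(- A_i(nu) / s); the extended exponential is used so
   that an infinite A_i(nu) would give weight 0 *)
Definition weight (nu : prob) (i : 'I_n) : R :=
  lambda i * a i `^ theta *
  fine (expeR (- (A_value tau0 tau1 (mu i) nu * ((tau0 + tau1)^-1)%:E))%E).

Definition Zpart (nu : prob) : R := \sum_i weight nu i.

Definition omega (nu : prob) (i : 'I_n) : R := weight nu i / Zpart nu.

Definition Phi (nu : prob) : R :=
  tau0 * (\sum_i lambda i * a i - Zpart nu `^ theta^-1).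

(* nu' = T(nu). For Gaussian nu and mu i the minimizer (p i, q i) exists, is
   unique and Gaussian, so this relation is the graph of T. *)
Definition moment_update (nu nu' : prob) : Prop :=
  exists (p q : 'I_n -> prob) (v : 'I_n -> 'cV[R]_d) (Q : 'I_n -> 'M[R]_d),
    (forall i, A_minimizer tau0 tau1 (mu i) nu (p i) (q i)) /\
    (forall i, is_gaussian (q i) (v i) (Q i)) /\
    let m' := \sum_i omega nu i *: v i in
    let S' := \sum_i omega nu i *: (Q i + (v i - m') *m (v i - m')^T) in
    is_gaussian nu' m' S'.

End barycenter.

(* Main.v *)
(* For each i, the minimizer (p_i, q_i) at nu^k is a competitor at nu^{k+1}, so
   A_i(nu^{k+1}) - A_i(nu^k) <= tau_1 (KL(q_i | nu^{k+1}) - KL(q_i | nu^k)), and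
   the right-hand side is tau_1 times the q_i-integral of the quadratic function
   ln (f_{nu^k} / f_{nu^{k+1}}), with f the Gaussian densities.  The mixture
   sum_i omega_i q_i and nu^{k+1} have the same first and second moments, so the
   omega-average of these bounds is -tau_1 KL(nu^{k+1} | nu^k).  Jensen's
   inequality for exp then gives
   Z(nu^{k+1}) >= Z(nu^k) exp (tau_1 KL(nu^{k+1} | nu^k) / s), and raising to the
   power 1 / theta and using exp x >= 1 + x yields the descent.

   The moments of N(m, S) are read off its moment generating function, which
   follows from the translation invariance of Lebesgue measure by completing the
   square; neither a linear change of variables nor the value of the normalizing
   constant is needed. *)

Require Import Defs.
From mathcomp Require Import all_boot all_order all_algebra.
From mathcomp Require Import all_classical all_reals all_analysis.
From HB Require Import structures.
From mathcomp Require Import measurable_realfun ring lra.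

Import Order.TTheory GRing.Theory Num.Theory.
Import numFieldNormedType.Exports.
Local Open Scope classical_set_scope.
Local Open Scope charge_scope.
Local Open Scope ring_scope.

Set Implicit Arguments.
Unset Strict Implicit.
Unset Printing Implicit Defensive.

(** * Lebesgue measure on tuples *)

(** The existential turns a measurability proof into a bundled measure. Since the equality is one of
    set functions, it can be used for rewriting. *)
Lemma pushforward_measure dT1 dT2 (T1 : measurableType dT1)
    (T2 : measurableType dT2) (R : realType) (mu : {measure set T1 -> \bar R})
    (f : T1 -> T2) : measurable_fun setT f ->
  exists m : {measure set T2 -> \bar R},
    (m : set _ -> \bar R) = pushforward mu f.
Proof. by move=> mf; unshelve eexists (pushforward mu f). Qed.

Section sigma_finite_measure_of.
Context dT (T : measurableType dT) (R : realType).
Variables (m : {measure set T -> \bar R}) (mfin : sigma_finite setT m).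

Let m' : set T -> \bar R := m.
HB.instance Definition _ := Measure.on m'.
HB.instance Definition _ := Measure_isSigmaFinite.Build _ _ _ m' mfin.

Lemma sigma_finite_measure_of_measure :
  exists L : {sigma_finite_measure set T -> \bar R}, (L : set _ -> \bar R) = m.
Proof. by exists m'. Qed.

End sigma_finite_measure_of.

Lemma pushforward_product_sigma_finite dT1 dT2 dT3 (T1 : measurableType dT1)
    (T2 : measurableType dT2) (T3 : measurableType dT3) (R : realType)
    (m1 : {sigma_finite_measure set T1 -> \bar R})
    (m2 : {sigma_finite_measure set T2 -> \bar R})
    (f : T1 * T2 -> T3) (g : T3 -> T1 * T2) :
  measurable_fun setT f -> measurable_fun setT g -> cancel f g ->
  exists L : {sigma_finite_measure set T3 -> \bar R},
    (L : set _ -> \bar R) = pushforward (m1 \x m2)%E f.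
Proof.
move=> mf mg fK.
have [L LE] := pushforward_measure
  [the {measure set _ -> \bar R} of (m1 \x m2)%E] mf.
have Lfin : sigma_finite setT L.
  have /sigma_finiteP[F [FT Fnd Ffin]] := sigma_finiteT m1.
  have /sigma_finiteP[G [GT Gnd Gfin]] := sigma_finiteT m2.
  exists (fun k => g @^-1` (F k `*` G k)).
    apply/esym; rewrite -subTset => x _.
    have [i _ Fi] : (\bigcup_k F k) (g x).1 by rewrite -FT.
    have [j _ Gj] : (\bigcup_k G k) (g x).2 by rewrite -GT.
    exists (maxn i j) => //; split.
      by have /subsetPset := Fnd _ _ (leq_maxl i j); exact.
    by have /subsetPset := Gnd _ _ (leq_maxr i j); exact.
  move=> k; have [mF Foo] := Ffin k; have [mG Goo] := Gfin k; split.
    by rewrite -[X in measurable X]setTI; apply: mg => //; exact: measurableX.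
  rewrite LE /pushforward -comp_preimage (_ : g \o f = id); last exact/funext.
  by rewrite preimage_id /= product_measure1E// lte_mul_pinfty// ge0_fin_numE.
rewrite -LE; exact: sigma_finite_measure_of_measure.
Qed.

(** The pushforward of the product measure agrees with it on rectangles, and a product measure is
    determined by its values there. *)
Lemma product_measure_preserved dT1 dT2 (T1 : measurableType dT1)
    (T2 : measurableType dT2) (R : realType)
    (m1 : {sigma_finite_measure set T1 -> \bar R})
    (m2 : {sigma_finite_measure set T2 -> \bar R}) (f : T1 -> T1) (g : T2 -> T2) :
  measurable_fun setT f -> measurable_fun setT g ->
  (forall A, measurable A -> m1 (f @^-1` A) = m1 A) ->
  (forall A, measurable A -> m2 (g @^-1` A) = m2 A) ->
  forall A, measurable A ->
  (m1 \x m2)%E ((fun z => (f z.1, g z.2)) @^-1` A) = (m1 \x m2)%E A.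
Proof.
move=> mf mg fm gm A mA.
have mh : measurable_fun setT (fun z : T1 * T2 => (f z.1, g z.2)).
  apply/measurable_fun_pairP; split.
    exact: (measurableT_comp mf measurable_fst).
  exact: (measurableT_comp mg measurable_snd).
have [m mE] := pushforward_measure
  [the {measure set _ -> \bar R} of (m1 \x m2)%E] mh.
rewrite [RHS](product_measure_unique (m' := m))// ?mE// => B C mB mC.
rewrite /pushforward (_ : _ @^-1` _ = (f @^-1` B) `*` (g @^-1` C)).
  rewrite /= product_measure1E; first by rewrite fm// gm.
    by rewrite -[X in measurable X]setTI; exact: mf.
  by rewrite -[X in measurable X]setTI; exact: mg.
by apply/seteqP; split.
Qed.

(** * Sigma-finiteness and translation invariance *)

Section lebesgueRn.
Context {R : realType}.
Local Open Scope ereal_scope.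

Definition shift_tuple (d : nat) (t x : d.-tuple R) : d.-tuple R :=
  [tuple (tnth x i + tnth t i)%R | i < d].

Lemma measurable_shift_tuple d (t : d.-tuple R) :
  measurable_fun setT (shift_tuple t).
Proof.
apply/measurable_fun_tnthP => i.
rewrite (_ : _ \o _ = fun x => (tnth x i + tnth t i)%R); last first.
  by apply/funext => x /=; rewrite tnth_mktuple.
by apply: measurable_funD => //; exact: measurable_tnth.
Qed.

Let tcons d (z : R * d.-tuple R) : d.+1.-tuple R := [tuple of z.1 :: z.2].

Let measurable_tcons d : measurable_fun setT (@tcons d).
Proof. exact: measurable_cons. Qed.

(** [lebesgueRn] is a bare set function. This bundles it so that product measures and Radon-Nikodym
    derivatives apply; splitting a tuple into head and tail provides the inverse of [tcons]. *)
Lemma lebesgueRn_sigma_finite d :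
  exists lam : {sigma_finite_measure set (d.-tuple R) -> \bar R},
    (lam : set _ -> \bar R) = lebesgueRn d.
Proof.
elim: d => [|d [lam lamE]].
  by exists (\d_([tuple] : 0.-tuple R)).
pose g (x : d.+1.-tuple R) := (thead x, [tuple of behead x]).
have mg : measurable_fun setT g.
  by apply/measurable_fun_pairP; split;
    [exact: measurable_tnth|exact: measurable_behead].
have gK : cancel (@tcons d) g.
  by move=> [x y]; rewrite /g/= theadE; congr (_, _); exact: val_inj.
have [L LE] := pushforward_product_sigma_finite (@lebesgue_measure R) lam
  (@measurable_tcons d) mg gK.
by exists L; rewrite /= LE lamE.
Qed.

Lemma lebesgue_measure_shift (t : R) A : measurable A ->
  @lebesgue_measure R ((fun x => x + t)%R @^-1` A) = lebesgue_measure A.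
Proof.
move=> mA.
have mt : measurable_fun setT (fun x : R => x + t)%R.
  exact: measurable_funD.
have [m mE] := @pushforward_measure _ _ (measurableTypeR R) (measurableTypeR R)
  R (@lebesgue_measure R) _ mt.
rewrite [RHS](lebesgue_measure_unique (mu := m)) ?mE// => X [[a b] _ <-].
rewrite /pushforward (_ : _ @^-1` _ = `](a - t)%R, (b - t)%R]%classic).
  rewrite lebesgue_measure_itv [RHS]lebesgue_measure_itv/= !lte_fin ltrD2r; case: ifPn => // _.
  by rewrite -!EFinB; congr EFin; ring.
by apply/seteqP; split => x /=; rewrite !in_itv/= ltrBlDr lerBrDr.
Qed.

(** By induction on [d]: in head-tail coordinates a shift is the product of a shift of the line and
    a shift of the tail. *)
Lemma lebesgueRn_shift d (t : d.-tuple R) A : measurable A ->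
  lebesgueRn d (shift_tuple t @^-1` A) = lebesgueRn d A.
Proof.
elim: d => [|d IH] in t A *.
  move=> mA; rewrite /lebesgueRn/= !diracE; congr (_%:E); congr (nat_of_bool _)%:R.
  by apply/idP/idP; rewrite !inE/= (tuple0 (shift_tuple t _)).
move=> mA; have [lam lamE] := lebesgueRn_sigma_finite d.
rewrite /= /pushforward -lamE.
have mB : measurable (@tcons d @^-1` A).
  by rewrite -[X in measurable X]setTI; exact: measurable_tcons.
rewrite -[RHS](@product_measure_preserved _ _ (measurableTypeR R) _ R
  (@lebesgue_measure R) lam (fun x => x + thead t)%R
  (shift_tuple [tuple of behead t]))//; last 4 first.
- exact: measurable_funD.
- exact: measurable_shift_tuple.
- exact: lebesgue_measure_shift.
- by move=> B mB'; rewrite lamE IH.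
congr (_ _); apply/seteqP; split => -[x y] /=;
rewrite /tcons/=; (suff -> : shift_tuple t [tuple of x :: y] =
  [tuple of (x + thead t)%R :: shift_tuple [tuple of behead t] y] by []);
apply: eq_from_tnth => i; rewrite tnth_mktuple;
(have [->|[j ->]] : i = ord0 \/ exists j, i = lift ord0 j
  by case: (unliftP ord0 i) => [j ->|->]; [right; exists j|left]);
by rewrite ?tnth0// !tnthS tnth_mktuple [in LHS](tuple_eta t) tnthS.
Qed.

End lebesgueRn.

(** * Means, densities and relative entropy *)

Section has_mean.
Context dT (T : measurableType dT) (R : realType).
Implicit Types (P : {measure set T -> \bar R}) (g h : T -> R) (r s : R).

(** Integrability and value travel together, so linear combinations are computed without separate
    side conditions. [P] may be any measure, so that integrals of densities are covered as well. *)
Definition has_mean P g r : Prop :=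
  P.-integrable setT (EFin \o g) /\ (\int[P]_x (g x)%:E = r%:E)%E.

Lemma has_mean_measurable P g r : has_mean P g r -> measurable_fun setT g.
Proof. by move=> [/measurable_int/measurable_EFinP]. Qed.

Lemma has_mean_eq P g h r s : has_mean P g r -> g =1 h -> r = s -> has_mean P h s.
Proof. by move=> + /funext <- <-. Qed.

Lemma has_meanD P g h r s : has_mean P g r -> has_mean P h s ->
  has_mean P (g \+ h) (r + s).
Proof.
move=> [ig gr] [ih hs]; split.
  by rewrite (_ : _ \o _ = (EFin \o g) \+ (EFin \o h))%E//; exact: integrableD.
by under eq_integral do rewrite EFinD; rewrite integralD// gr hs.
Qed.

Lemma has_meanZ P k g r : has_mean P g r -> has_mean P (k \*o g) (k * r).
Proof.
move=> [ig gr]; split.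
  rewrite (_ : _ \o _ = fun x => k%:E * (EFin \o g) x)%E//; exact: integrableZl.
by under eq_integral do rewrite EFinM; rewrite integralZl// gr.
Qed.

Lemma has_meanB P g h r s : has_mean P g r -> has_mean P h s ->
  has_mean P (g \- h) (r - s).
Proof.
move=> gr hs; apply: has_mean_eq (has_meanD gr (has_meanZ (-1) hs)) _ _ => [x/=|];
  by rewrite mulN1r.
Qed.

Lemma has_mean_sum P (I : Type) (l : seq I) (g : I -> T -> R) (r : I -> R) :
  (forall i, has_mean P (g i) (r i)) ->
  has_mean P (fun x => \sum_(i <- l) g i x) (\sum_(i <- l) r i).
Proof.
move=> gr; elim: l => [|i l IH].
  split; last by under eq_integral do rewrite big_nil; rewrite integral0 big_nil.
  by rewrite (_ : _ \o _ = cst 0%E) ?integrable0//; apply/funext => x/=; rewrite big_nil.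
by apply: has_mean_eq (has_meanD (gr i) IH) _ _ => [x/=|]; rewrite big_cons.
Qed.

Lemma has_mean_cst (P : probability T R) r : has_mean P (cst r) r.
Proof.
split; first exact: finite_measure_integrable_cst.
transitivity (r%:E * P setT)%E.
  exact: (integral_cst P measurableT r%:E).
by rewrite probability_setT mule1.
Qed.

Lemma ge0_has_mean P g r : measurable_fun setT g -> (forall x, 0 <= g x) ->
  (\int[P]_x (g x)%:E = r%:E)%E -> has_mean P g r.
Proof.
move=> mg g0 gr; split => //; apply/integrableP; split; first exact/measurable_EFinP.
under eq_integral => x _ do rewrite /= ger0_norm//.
by rewrite gr ltry.
Qed.

Lemma has_mean_le P g h r s : has_mean P g r -> has_mean P h s ->
  (forall x, g x <= h x) -> r <= s.
Proof.
move=> [ig gr] [ih hs] gh; rewrite -lee_fin -gr -hs.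
by apply: le_integral => // x _; rewrite lee_fin.
Qed.

Lemma has_mean_dominated P g h s : measurable_fun setT g -> has_mean P h s ->
  (forall x, `|g x| <= h x) -> exists r, has_mean P g r.
Proof.
move=> mg [ih _] gh.
have ig : P.-integrable setT (EFin \o g).
  apply: le_integrable ih => //; first exact/measurable_EFinP.
  by move=> x _; rewrite /= lee_fin (le_trans (gh x))// ler_norm.
exists (fine (\int[P]_x (g x)%:E)%E); split => //.
by rewrite fineK//; exact: integrable_fin_num.
Qed.

End has_mean.

Section has_density.
Context dT (T : measurableType dT) (R : realType).
Variables (mu : {sigma_finite_measure set T -> \bar R}) (p : probability T R).

Definition has_density (w : T -> R) : Prop :=
  [/\ measurable_fun setT w, forall x, 0 <= w x &
      forall A, measurable A -> (p A = \int[mu]_(x in A) (w x)%:E)%E].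

Variable w : T -> R.
Hypothesis pw : has_density w.

Lemma has_density_dominates : p `<< mu.
Proof.
have [mw w0 pE] := pw; apply/null_content_dominatesP => A mA A0.
rewrite pE//; apply: null_set_integral => //.
by apply: measurable_funTS; exact/measurable_EFinP.
Qed.

Lemma has_density_mean1 : has_mean mu w 1.
Proof.
have [mw w0 pE] := pw.
by apply: ge0_has_mean; rewrite // -pE// probability_setT.
Qed.

(** Both functions have integral [p A] over every measurable [A]. *)
Lemma has_density_ae_eq :
  ae_eq mu setT ('d (charge_of_finite_measure p) '/d mu) (EFin \o w).
Proof.
have [mw w0 pE] := pw; have pmu := has_density_dominates.
have ri : mu.-integrable setT ('d (charge_of_finite_measure p) '/d mu).
  exact: Radon_Nikodym_integrable.
apply: integral_ae_eq => //.
  exact/measurable_EFinP.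
move=> A _ mA; rewrite -pE//; apply/esym.
exact: (@Radon_Nikodym_integral _ _ _ (charge_of_finite_measure p) mu A pmu mA).
Qed.

Lemma ge0_integral_density (g : T -> R) : measurable_fun setT g ->
  (forall x, 0 <= g x) ->
  (\int[p]_x (g x)%:E = \int[mu]_x (g x * w x)%:E)%E.
Proof.
have [mw w0 pE] := pw; have pmu := has_density_dominates => mg g0.
rewrite -(Radon_Nikodym_SigmaFinite.change_of_variables pmu)//; last exact/measurable_EFinP.
apply: ae_eq_integral => //.
- apply: emeasurable_funM; first exact/measurable_EFinP.
  exact: measurable_int (Radon_Nikodym_SigmaFinite.f_integrable pmu).
- by apply/measurable_EFinP; exact: measurable_funM.
have := ae_eq_Radon_Nikodym_SigmaFinite pmu measurableT.
move/ae_eq_trans/(_ has_density_ae_eq).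
by apply: filterS => x /(_ I) /= -> _.
Qed.

Lemma has_mean_density (g : T -> R) r : has_mean p g r ->
  has_mean mu (g \* w) r.
Proof.
have [mw w0 pE] := pw; have pmu := has_density_dominates => gr.
have mg := has_mean_measurable gr; split.
  apply/integrableP; split; first by apply/measurable_EFinP/measurable_funM.
  under eq_integral => x _ do rewrite /= normrM (ger0_norm (w0 x)).
  have mng : measurable_fun setT (fun x => `|g x|) by exact: measurableT_comp.
  rewrite -(ge0_integral_density mng (fun x => normr_ge0 (g x))).
  by have [/integrableP[_]] := gr.
rewrite -[RHS]gr.2 -(Radon_Nikodym_change_of_variables pmu)//; last exact: gr.1.
apply: ae_eq_integral => //.
- by apply/measurable_EFinP/measurable_funM.
- by apply: emeasurable_funM => //; exact/measurable_EFinP.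
by apply: filterS has_density_ae_eq => x /(_ I) /= -> _.
Qed.

End has_density.

(** * Relative entropy: sign, vanishing, and evaluation from an explicit density *)

Section KL.
Context dT (T : measurableType dT) (R : realType).
Implicit Types p q : probability T R.

Let h (r : R) := r * ln r - r + 1.

(** For [r <= 0] the convention on [ln] leaves [1 - r]. For [r > 0], multiply the strict inequality
    [1 + y < expR y] at [y = - ln r] by [r]. *)
Let h_gt0 r : r != 1 -> 0 < h r.
Proof.
move=> r1; rewrite /h; have [r0|r0] := leP r 0.
  by rewrite ln0//; lra.
have lr0 : - ln r != 0 by rewrite oppr_eq0 ln_eq0.
have rE : expR (- ln r) = r^-1 by rewrite expRN lnK.
have := expR_gt1Dx lr0; rewrite rE -(ltr_pM2l r0) mulfV ?gt_eqF//; lra.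
Qed.

Let h_ge0 r : 0 <= h r.
Proof.
have [->|/h_gt0/ltW//] := eqVneq r 1.
by rewrite /h ln1 mulr0 add0r addNr.
Qed.

Let measurable_h : measurable_fun setT h.
Proof.
apply: measurable_funD => //; apply: measurable_funB => //.
by apply: measurable_funM => //; exact: measurable_ln.
Qed.

Let KLE p q : p `<< q -> KL p q =
  (\int[q]_x (h (fine (('d (charge_of_finite_measure p) '/d q) x)))%:E)%E.
Proof. by move=> pq; rewrite /KL asboolT. Qed.

Lemma KL_ge0 p q : (0 <= KL p q)%E.
Proof.
rewrite /KL; case: ifPn => // _.
by apply: integral_ge0 => x _; rewrite lee_fin; exact: h_ge0.
Qed.

Let measurable_dens p q : p `<< q -> measurable_fun setT
  (fun x => fine (('d (charge_of_finite_measure p) '/d q) x)).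
Proof.
by move=> pq; apply: measurableT_comp.
Qed.

(** A vanishing integral of the nonnegative [h] forces [h = 0] almost everywhere. The only zero of
    [h] is 1, so the density of [p] is 1 almost everywhere. *)
Lemma KL_eq0 p q : KL p q = 0%E -> meas_eq p q.
Proof.
have [pq|npq] := pselect (p `<< q); last by rewrite /KL asboolF.
rewrite KLE// => KL0.
have mr := measurable_dens pq.
have /ae_eq_integral_abs : (\int[q]_x `|(h (fine
    (('d (charge_of_finite_measure p) '/d q) x)))%:E| = 0)%E.
  by under eq_integral => x _ do rewrite /= ger0_norm//.
move=> /(_ measurableT) h0.
have r1 : ae_eq q setT ('d (charge_of_finite_measure p) '/d q) (cst 1%E).
  have h0' := (h0 (proj2 (measurable_EFinP _ _) (measurableT_comp measurable_h mr))).
  apply: filterS h0' => x /(_ I) hx _.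
  rewrite -(fineK (@Radon_Nikodym_fin_num _ _ _ (charge_of_finite_measure p) q x pq)); congr EFin; apply/eqP.
  by apply/negPn/negP => /h_gt0; rewrite (EFin_inj hx) ltxx.
move=> A mA.
rewrite [LHS](@Radon_Nikodym_integral _ _ _ (charge_of_finite_measure p) q A pq mA).
rewrite (ae_eq_integral (cst 1%E))//.
- by rewrite integral_cst// mul1e.
- exact: measurable_funTS.
- exact: ae_eq_subset r1.
Qed.

(** The [q]-mean of [w * ln w] is the [p]-mean of [ln w], and the terms [- w + 1] integrate to 0. *)
Lemma KL_density p q w k : has_density q p w -> has_mean p (fun x => ln (w x)) k ->
  KL p q = k%:E.
Proof.
move=> pw lnk; rewrite KLE; last exact: has_density_dominates pw.
have [_ <-] : has_mean q (h \o w) k.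
  apply: has_mean_eq (has_meanD (has_meanB (has_mean_density pw lnk)
    (has_density_mean1 pw)) (has_mean_cst q 1)) _ _ => [x/=|].
    by rewrite /h mulrC.
  by rewrite subrK.
have [mw w0 pE] := pw; have pmu := has_density_dominates pw.
apply: ae_eq_integral => //.
- by apply/measurable_EFinP; apply: measurableT_comp => //; exact: measurable_dens.
- by apply/measurable_EFinP; exact: measurableT_comp.
by apply: filterS (has_density_ae_eq pw) => x /(_ I) /= -> _.
Qed.

(** The Radon-Nikodym derivatives with respect to [q] and [q'] are separately chosen functions. They
    agree almost everywhere because they have the same integrals over measurable sets. *)
Lemma KL_meas_eqr p q q' : meas_eq q q' -> KL p q = KL p q'.
Proof.
move=> qq'.
have dom : p `<< q <-> p `<< q'.
  split=> /null_content_dominatesP pq; apply/null_content_dominatesP => A mA A0;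
  apply: (pq A mA); [exact: etrans (qq' A mA) A0|exact: etrans (esym (qq' A mA)) A0].
have [pq|npq] := pselect (p `<< q); last first.
  by rewrite /KL !asboolF// -dom.
have pq' : p `<< q' by rewrite -dom.
rewrite !KLE// [RHS](eq_measure_integral q); last first.
  by move=> A mA _; exact: esym (qq' A mA).
apply: ae_eq_integral => //.
- by apply/measurable_EFinP; apply: measurableT_comp => //; exact: measurable_dens.
- by apply/measurable_EFinP; apply: measurableT_comp => //; exact: measurable_dens.
suff : ae_eq q setT ('d (charge_of_finite_measure p) '/d q)
    ('d (charge_of_finite_measure p) '/d q').
  by apply: filterS => x /(_ I) -> _.
have ri : q.-integrable setT ('d (charge_of_finite_measure p) '/d q).
  exact: Radon_Nikodym_integrable.
apply: integral_ae_eq => // A _ mA.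
transitivity (p A).
  by apply/esym; exact: (@Radon_Nikodym_integral _ _ _ (charge_of_finite_measure p) q A pq mA).
rewrite [RHS](eq_measure_integral q'); last by move=> B mB _; exact: qq'.
exact: (@Radon_Nikodym_integral _ _ _ (charge_of_finite_measure p) q' A pq' mA).
Qed.

End KL.

(** * Moments from the moment generating function *)

Section exp_bounds.
Context {R : realType}.
Implicit Types x y e : R.

Lemma le0_of_le_small (a C : R) : (forall e, 0 < e <= 1 -> a <= e * C) -> a <= 0.
Proof.
move=> aC; rewrite leNgt; apply/negP => a0.
have K0 : 0 < 2 * (`|C| + a) by have := normr_ge0 C; lra.
have e01 : 0 < a / (2 * (`|C| + a)) <= 1.
  by rewrite divr_gt0//= ler_pdivrMr// mul1r; have := normr_ge0 C; lra.
have := aC _ e01; rewrite mulrAC ler_pdivlMr//.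
have : a * C <= a * `|C| by rewrite ler_pM2l// ler_norm.
have := mulr_gt0 a0 a0; have := mulr_ge0 (ltW a0) (normr_ge0 C).
rewrite mulrCA mulrDr; lra.
Qed.

Lemma expR_norm_le x : expR `|x| <= expR x + expR (- x).
Proof.
have := expR_ge0 x; have := expR_ge0 (- x).
by case: (ler0P x) => _; lra.
Qed.

Lemma expR_le1D x : expR x <= 1 + x * expR x.
Proof.
have := expR_ge1Dx (- x); rewrite -(ler_pM2r (expR_gt0 x)) -expRD addNr expR0.
lra.
Qed.

(** Half-angle formula. The absolute value makes the squared base nonnegative, so that squares can
    be compared through their bases. *)
Let coshE x : expR x + expR (- x) - 2 = (expR (`|x| / 2) - expR (- (`|x| / 2))) ^+ 2.
Proof.
have -> : (expR (`|x| / 2) - expR (- (`|x| / 2))) ^+ 2 =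
    expR (`|x| / 2) ^+ 2 + expR (- (`|x| / 2)) ^+ 2
    - 2 * (expR (`|x| / 2) * expR (- (`|x| / 2))) by ring.
rewrite -expRD subrr expR0 -!expRM_natl.
have -> : 2%:R * (`|x| / 2) = `|x| by field.
have -> : 2%:R * (- (`|x| / 2)) = - `|x| by field.
by case: (ler0P x) => _; rewrite ?opprK; lra.
Qed.

Let cosh_le x : expR x + expR (- x) - 2 <= x ^+ 2 * expR `|x|.
Proof.
rewrite coshE; set t := `|x| / 2.
have t0 : 0 <= t by rewrite divr_ge0.
have -> : x ^+ 2 * expR `|x| = (2 * t * expR t) ^+ 2.
  rewrite exprMn -expRM_natl.
  have -> : 2%:R * t = `|x| by rewrite /t; field.
  by rewrite real_normK ?num_real.
rewrite lerXn2r ?nnegrE ?mulr_ge0 ?expR_ge0//.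
  by rewrite subr_ge0 ler_expR; lra.
have := ler_wpM2r (expR_ge0 t) (expR_ge1Dx (- (2 * t))); rewrite -expRD.
have -> : - (2 * t) + t = - t by ring.
lra.
Qed.

Let cosh_ge x : x ^+ 2 * expR (- `|x|) <= expR x + expR (- x) - 2.
Proof.
rewrite coshE; set t := `|x| / 2.
have t0 : 0 <= t by rewrite divr_ge0.
have -> : x ^+ 2 * expR (- `|x|) = (2 * t * expR (- t)) ^+ 2.
  rewrite exprMn -expRM_natl.
  have -> : 2%:R * t = `|x| by rewrite /t; field.
  have -> : 2%:R * - t = - `|x| by rewrite /t; field.
  by rewrite real_normK ?num_real.
rewrite lerXn2r ?nnegrE ?mulr_ge0 ?expR_ge0//.
  by rewrite subr_ge0 ler_expR; lra.
have := ler_wpM2r (expR_ge0 (- t)) (expR_ge1Dx (2 * t)); rewrite -expRD.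
have -> : 2 * t + - t = t by ring.
lra.
Qed.

(* [cosh_le] and [cosh_ge] pinch [2 (cosh y - 1)] between [y^2 exp (- |y|)] and
   [y^2 exp |y|], so no calculus is needed for the second order expansion. *)
Lemma cosh_taylor2 e x : 0 < e <= 1 ->
  `|expR (e * x) + expR (- (e * x)) - 2 - e ^+ 2 * x ^+ 2| <=
  6 * e ^+ 3 * (expR (2 * x) + expR (- (2 * x))).
Proof.
move=> /andP[e0 e1].
have eN : `|e * x| = e * `|x| by rewrite normrM gtr0_norm.
have x3 : `|x| ^+ 3 * expR `|x| <= 6 * (expR (2 * x) + expR (- (2 * x))).
  have h1 : `|x| ^+ 3 <= 6 * expR `|x|.
    have := @expR_ge1Dxn R `|x| 2 (normr_ge0 x).
    have -> : 3`!%:R = 6 :> R by [].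
    have -> : `|x| ^+ 3 = 6 * (`|x| ^+ 3 / 6) by field.
    set z := `|x| ^+ 3 / 6; lra.
  apply: le_trans (_ : 6 * expR `|x| * expR `|x| <= _).
    by rewrite ler_wpM2r ?expR_ge0.
  rewrite -mulrA ler_pM2l// -expRD.
  have -> : `|x| + `|x| = `|2 * x| by rewrite normrM ger0_norm//; ring.
  exact: expR_norm_le.
have e3 : 0 < e ^+ 3 by rewrite exprn_gt0.
have x2 : 0 <= e ^+ 2 * x ^+ 2 by rewrite mulr_ge0 ?sqr_ge0.
have key : e ^+ 2 * x ^+ 2 * (e * `|x| * expR `|x|) <=
    6 * e ^+ 3 * (expR (2 * x) + expR (- (2 * x))).
  have -> : e ^+ 2 * x ^+ 2 * (e * `|x| * expR `|x|) =
      e ^+ 3 * (`|x| ^+ 3 * expR `|x|).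
    by rewrite -(@real_normK _ x) ?num_real//; ring.
  by rewrite [6 * _]mulrC -[leRHS]mulrA ler_pM2l.
have up : expR (e * `|x|) - 1 <= e * `|x| * expR `|x|.
  have := expR_le1D (e * `|x|).
  have : e * `|x| * expR (e * `|x|) <= e * `|x| * expR `|x|.
    rewrite ler_wpM2l ?mulr_ge0 ?(ltW e0)// ler_expR.
    by rewrite -[leRHS]mul1r ler_wpM2r.
  lra.
have dn : 1 - expR (- (e * `|x|)) <= e * `|x| * expR `|x|.
  have := expR_ge1Dx (- (e * `|x|)).
  have : e * `|x| * 1 <= e * `|x| * expR `|x|.
    by rewrite ler_wpM2l ?mulr_ge0 ?(ltW e0)// -expR0 ler_expR.
  lra.
have := ler_wpM2l x2 up; have := ler_wpM2l x2 dn.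
have := cosh_le (e * x); have := cosh_ge (e * x); rewrite eN exprMn.
rewrite !mulrBr mulr1 => h1 h2 h3 h4.
by rewrite ler_norml; apply/andP; split; lra.
Qed.

End exp_bounds.

(** Exponential moments dominate [X] and [X ^+ 2], so both have means. These are identified by
    expanding the generating function at small [e], to first order for [X] and to second order for
    [X ^+ 2]. *)
Lemma moments_of_mgf (R : realType) dT (T : measurableType dT) (P : probability T R) (X : T -> R) (s : R) :
  measurable_fun setT X ->
  (forall e, has_mean P (fun x => expR (e * X x)) (expR (e ^+ 2 * s / 2))) ->
  has_mean P X 0 /\ has_mean P (fun x => X x ^+ 2) s.
Proof.
move=> mX mgf.
have mgfN e : has_mean P (fun x => expR (- (e * X x))) (expR (e ^+ 2 * s / 2)).
  by apply: has_mean_eq (mgf (- e)) _ _ => [x|]; rewrite ?mulNr// sqrrN.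
have dom e := has_meanD (mgf e) (mgfN e).
have [r1 Xr1] : exists r, has_mean P X r.
  apply: has_mean_dominated mX (dom 1) _ => x /=; rewrite !mul1r.
  apply: le_trans (expR_norm_le _).
  have := expR_ge1Dx `|X x|; lra.
have [r2 Xr2] : exists r, has_mean P (fun x => X x ^+ 2) r.
  apply: has_mean_dominated (has_meanZ 2 (dom 1)) _ => [|x /=].
    exact: measurable_funX.
  rewrite !mul1r; apply: le_trans (_ : 2 * expR `|X x| <= _); last first.
    by rewrite ler_pM2l// expR_norm_le.
  have := @expR_ge1Dxn R `|X x| 1 (normr_ge0 _).
  rewrite [`|_ ^+ 2|]ger0_norm ?sqr_ge0// real_normK ?num_real//.
  have -> : 2`!%:R = 2 :> R by [].
  lra.
(* A bound on the generating function, uniform in [0 < e <= 1]; the sign of [s] is not known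
   here. *)
pose K := expR (`|s| / 2).
have tK e : 0 < e <= 1 -> expR (e ^+ 2 * s / 2) <= K.
  move=> /andP[e0 e1]; rewrite ler_expR ler_pM2r ?invr_gt0//.
  apply: le_trans (_ : e ^+ 2 * `|s| <= _).
    by rewrite ler_wpM2l ?sqr_ge0// ler_norm.
  by rewrite -[leRHS]mul1r ler_wpM2r// exprn_ile1 ?(ltW e0).
have tB e : 0 < e <= 1 ->
    expR (e ^+ 2 * s / 2) - 1 <= e ^+ 2 * (`|s| / 2 * K).
  move=> e01; have := expR_le1D (e ^+ 2 * s / 2).
  suff : e ^+ 2 * s / 2 * expR (e ^+ 2 * s / 2) <= e ^+ 2 * (`|s| / 2 * K) by lra.
  apply: le_trans (_ : e ^+ 2 * (`|s| / 2) * expR (e ^+ 2 * s / 2) <= _).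
    rewrite ler_wpM2r ?expR_ge0// -mulrA ler_wpM2l ?sqr_ge0//.
    by rewrite ler_pM2r ?invr_gt0// ler_norm.
  by rewrite [leRHS]mulrA ler_wpM2l ?tK// mulr_ge0 ?sqr_ge0 ?divr_ge0.
have r1le (e : R) : e * r1 <= expR (e ^+ 2 * s / 2) - 1.
  have := has_mean_le (has_meanD (has_mean_cst P 1) (has_meanZ e Xr1)) (mgf e)
    (fun x => expR_ge1Dx _); lra.
(* [r1le] bounds [e * r1] by a quantity of order [e ^+ 2]; taking it at [e] and at [- e] bounds [r1]
   on both sides. *)
have r10 : r1 = 0.
  apply/eqP; rewrite eq_le -oppr_le0; apply/andP; split;
  apply: (@le0_of_le_small R _ (`|s| / 2 * K)) => e e01; have /andP[e0 _] := e01;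
  rewrite -(ler_pM2l e0) mulrA -expr2; apply: le_trans (tB e e01).
    exact: r1le.
  by have := r1le (- e); rewrite sqrrN; lra.
split; first by rewrite -r10.
(* The mean of [cosh_taylor2]. The two exponentials of its error term both have mean [expR (2 * s)],
   whence [12 = 6 * 2]. *)
have r2B e : 0 < e <= 1 ->
    `|2 * (expR (e ^+ 2 * s / 2) - 1) - e ^+ 2 * r2| <= 12 * e ^+ 3 * expR (2 * s).
  move=> e01.
  have D := has_meanB (has_meanB (dom e) (has_mean_cst P 2)) (has_meanZ (e ^+ 2) Xr2).
  have B := has_meanZ (6 * e ^+ 3) (dom 2).
  have h1 := has_mean_le D B _.
  have h2 := has_mean_le (has_meanZ (-1) B) D _.
  have tay x := cosh_taylor2 (X x) e01.
  have := h1 (fun x => le_trans (ler_norm _) (tay x)).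
  have : - 1 * (6 * e ^+ 3 * (expR (2 ^+ 2 * s / 2) + expR (2 ^+ 2 * s / 2))) <=
      expR (e ^+ 2 * s / 2) + expR (e ^+ 2 * s / 2) - 2 - e ^+ 2 * r2.
    apply: h2 => x /=; rewrite mulN1r lerNl; apply: le_trans (tay x).
    by rewrite -normrN ler_norm.
  have -> : 2 ^+ 2 * s / 2 = 2 * s by field.
  by move=> h3 h4; rewrite ler_norml; apply/andP; split; lra.
have -> : s = r2.
  apply/eqP; rewrite eq_le -subr_le0 -[X in _ && X]subr_le0; apply/andP; split.
    apply: (@le0_of_le_small R _ (12 * expR (2 * s))) => e e01; have /andP[e0 _] := e01.
    have e20 : 0 < e ^+ 2 by rewrite exprn_gt0.
    rewrite -(ler_pM2l e20).
    have := r2B e e01; rewrite ler_norml => /andP[_].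
    have := expR_ge1Dx (e ^+ 2 * s / 2).
    have -> : e ^+ 2 * (e * (12 * expR (2 * s))) = 12 * e ^+ 3 * expR (2 * s) by ring.
    rewrite mulrBr; lra.
  apply: (@le0_of_le_small R _ (12 * expR (2 * s) + s ^+ 2 / 2 * K)) => e e01.
  have /andP[e0 e1] := e01.
  have e20 : 0 < e ^+ 2 by rewrite exprn_gt0.
  rewrite -(ler_pM2l e20).
  have := r2B e e01; rewrite ler_norml => /andP[+ _].
  (* The bound [r2 <= s] needs [expR t <= 1 + t + t ^+ 2 * K] at [t = e ^+ 2 * s / 2]; then [e <= 1]
     weakens [e ^+ 4] to [e ^+ 3]. *)
  have : expR (e ^+ 2 * s / 2) - 1 <= e ^+ 2 * s / 2 + e ^+ 3 * (s ^+ 2 / 4) * K.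
    have := expR_le1D (e ^+ 2 * s / 2); set t := e ^+ 2 * s / 2 => h.
    have K1 : 1 <= K by rewrite -expR0 ler_expR divr_ge0.
    have h2 : t * (expR t - 1) <= t ^+ 2 * K.
      have : expR t <= K by exact: tK.
      move: t {h} => t tK'; have [t0|t0] := leP 0 t.
        rewrite expr2 -mulrA ler_wpM2l//.
        apply: le_trans (_ : t * expR t <= _); last by rewrite ler_wpM2l.
        by have := expR_le1D t; lra.
      apply: le_trans (_ : t ^+ 2 * 1 <= _); last by rewrite ler_wpM2l ?sqr_ge0.
      by rewrite mulr1 ler_wnM2l ?(ltW t0)//; have := expR_ge1Dx t; lra.
    have h3 : t ^+ 2 * K <= e ^+ 3 * (s ^+ 2 / 4) * K.
      have -> : t ^+ 2 = e ^+ 4 * (s ^+ 2 / 4) by rewrite /t; field.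
      rewrite ler_wpM2r ?expR_ge0// ler_wpM2r ?divr_ge0 ?sqr_ge0//.
      by rewrite exprS -[leRHS]mul1r ler_wpM2r// exprn_ge0// ltW.
    lra.
  have -> : e ^+ 2 * (e * (12 * expR (2 * s) + s ^+ 2 / 2 * K)) =
    12 * e ^+ 3 * expR (2 * s) + 2 * (e ^+ 3 * (s ^+ 2 / 4) * K) by field.
  rewrite mulrBr; lra.
exact: Xr2.
Qed.

(** * Gaussian measures *)

Section sym_posdef.
Context {R : realType} {d : nat}.
Implicit Types (S M : 'M[R]_d) (u v : 'cV[R]_d).

(** A nonzero row of the kernel would be a nonzero vector on which the quadratic form vanishes. *)
Lemma sym_posdef_unitmx S : sym_posdef S -> S \in unitmx.
Proof.
move=> [_ S0]; rewrite -row_free_unit -kermx_eq0; apply/eqP/row_matrixP => i.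
rewrite row0; apply/eqP/negPn/negP => k0.
have /S0 : (row i (kermx S))^T != 0 by rewrite trmx_eq0.
rewrite trmxK; suff -> : row i (kermx S) *m S = 0 by rewrite mul0mx mxE ltxx.
by apply: sub_kermxP; exact: row_sub.
Qed.

Lemma tr_mx11 (A : 'M[R]_1) : A^T = A.
Proof. by apply/matrixP => i j; rewrite mxE !ord1. Qed.

Lemma mulmx_colE (u v : 'cV[R]_d) : (u^T *m v) 0 0 = \sum_i u i 0 * v i 0.
Proof. by rewrite mxE; apply: eq_bigr => i _; rewrite mxE. Qed.

Lemma quadE (v : 'cV[R]_d) M :
  (v^T *m M *m v) 0 0 = \sum_i \sum_j M i j * (v i 0 * v j 0).
Proof.
rewrite -mulmxA mulmx_colE; apply: eq_bigr => i _.
rewrite mxE mulr_sumr; apply: eq_bigr => j _; ring.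
Qed.

(* Completing the square: the mgf of N(m, S) at [u] is a translation by [S u]. *)
Lemma quad_shift S u v : sym_posdef S ->
  ((v - S *m u)^T *m invmx S *m (v - S *m u)) 0 0 =
  (v^T *m invmx S *m v) 0 0 - 2 * (u^T *m v) 0 0 + (u^T *m S *m u) 0 0.
Proof.
move=> Sp; have Su := sym_posdef_unitmx Sp; have [St _] := Sp.
have -> : (v - S *m u)^T *m invmx S *m (v - S *m u) =
    v^T *m invmx S *m v - v^T *m u - u^T *m v + u^T *m S *m u.
  have -> : (v - S *m u)^T = v^T - u^T *m S.
    by rewrite [LHS]linearB/= trmx_mul St.
  rewrite !mulmxBl !mulmxBr !mulmxA !(mulmxK Su) (mulmxKV Su).
  by rewrite opprB addrA [LHS]addrAC; congr (_ + _); rewrite addrAC.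
rewrite -(tr_mx11 (v^T *m u)) trmx_mul trmxK !mxE; ring.
Qed.

End sym_posdef.

Section gaussian.
Context {R : realType} {d : nat}.
Local Notation E := (d.-tuple R).
Implicit Types (S M : 'M[R]_d) (m c u v : 'cV[R]_d) (P : probability E R).

Lemma colvE (x : E) c i : (colv x - c) i 0 = tnth x i - c i 0.
Proof. by rewrite !mxE. Qed.

Lemma measurable_colv c i : measurable_fun setT (fun x : E => (colv x - c) i 0).
Proof.
under eq_fun do rewrite colvE.
by apply: measurable_funB => //; exact: measurable_tnth.
Qed.

Lemma measurable_quad c M :
  measurable_fun setT (fun x : E => ((colv x - c)^T *m M *m (colv x - c)) 0 0).
Proof.
under eq_fun do rewrite quadE.
apply: measurable_sum => i; apply: measurable_sum => j.
by apply: measurable_funM => //; apply: measurable_funM; exact: measurable_colv.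
Qed.

Lemma measurable_gaussian_pdf m S : measurable_fun setT (@gaussian_pdf R d m S).
Proof.
apply: measurable_funM => //; apply: measurableT_comp => //.
apply: measurable_funM => //; apply: measurableT_comp => //.
exact: measurable_quad.
Qed.

Definition gaussian_cst S : R := (Num.sqrt ((2 * pi) ^+ d * \det S))^-1.

Lemma gaussian_pdf_ge0 m S (x : E) : 0 <= gaussian_pdf m S x.
Proof. by rewrite mulr_ge0 ?expR_ge0// invr_ge0 sqrtr_ge0. Qed.

Lemma is_gaussian_density P m S
    (lam : {sigma_finite_measure set E -> \bar R}) :
  (lam : set _ -> \bar R) = lebesgueRn d ->
  is_gaussian P m S -> has_density lam P (gaussian_pdf m S).
Proof.
move=> lamE [_ PE]; split.
- exact: measurable_gaussian_pdf.
- exact: gaussian_pdf_ge0.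
- by move=> A mA; rewrite PE// lamE.
Qed.

(* [S] is the covariance of an actual probability, so its density cannot be the
   junk value 0 that [(sqrt _)^-1] would give if [\det S] were nonpositive. *)
Lemma gaussian_cst_gt0 P m S : is_gaussian P m S -> 0 < gaussian_cst S.
Proof.
move=> [_ PE]; rewrite lt_neqAle invr_ge0 sqrtr_ge0 andbT eq_sym.
apply/eqP => c0; have := probability_setT P; rewrite PE//=.
have [lam <-] := @lebesgueRn_sigma_finite R d.
under eq_integral do rewrite /gaussian_pdf -/(gaussian_cst S) c0 mul0r.
by rewrite integral0 => /eqP; rewrite eq_sym onee_eq0.
Qed.

Lemma gaussian_pdf_gt0 P m S x : is_gaussian P m S -> 0 < gaussian_pdf m S x.
Proof. by move=> /gaussian_cst_gt0 c0; rewrite mulr_gt0// expR_gt0. Qed.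

Lemma ln_gaussian_pdf P m S x : is_gaussian P m S ->
  ln (gaussian_pdf m S x) = ln (gaussian_cst S) -
    ((colv x - m)^T *m invmx S *m (colv x - m)) 0 0 / 2.
Proof.
move=> /gaussian_cst_gt0 c0.
by rewrite lnM ?posrE ?expR_gt0// expRK mulNr.
Qed.

Lemma gaussian_mgf P m S u : is_gaussian P m S ->
  has_mean P (fun x => expR ((u^T *m (colv x - m)) 0 0))
             (expR ((u^T *m S *m u) 0 0 / 2)).
Proof.
move=> Pg; have [Sp _] := Pg.
have [lam lamE] := @lebesgueRn_sigma_finite R d.
have Pd := is_gaussian_density lamE Pg.
have mexp : measurable_fun setT (fun x : E => expR ((u^T *m (colv x - m)) 0 0)).
  apply: measurableT_comp => //; under eq_fun do rewrite mulmx_colE.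
  apply: measurable_sum => i; apply: measurable_funM => //.
  exact: measurable_colv.
apply: ge0_has_mean => //.
rewrite (ge0_integral_density Pd mexp (fun=> expR_ge0 _)).
(* By [quad_shift], tilting the density by [u] is the same, up to a constant, as translating its
   argument by [- S u]. *)
pose t : E := [tuple - (S *m u) i 0 | i < d].
have pdfE x : expR ((u^T *m (colv x - m)) 0 0) * gaussian_pdf m S x =
    expR ((u^T *m S *m u) 0 0 / 2) * gaussian_pdf m S (shift_tuple t x).
  rewrite /gaussian_pdf.
  have -> : colv (shift_tuple t x) - m = colv x - m - S *m u.
    by apply/colP => i; rewrite !mxE !tnth_mktuple addrAC mxE.
  rewrite (quad_shift _ _ Sp) mulrCA [RHS]mulrCA -!expRD; congr (_ * expR _).
  by field.
under eq_integral do rewrite pdfE EFinM.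
rewrite ge0_integralZl//; last 2 first.
- by apply/measurable_EFinP; apply: measurableT_comp;
    [exact: measurable_gaussian_pdf|exact: measurable_shift_tuple].
- by move=> x _; rewrite lee_fin; exact: gaussian_pdf_ge0.
(* What remains is the integral of a translated density, which is 1 by invariance of Lebesgue
   measure. *)
rewrite -[RHS]mule1; congr (_ * _)%E; rewrite -(has_density_mean1 Pd).2.
rewrite -(@ge0_integral_pushforward _ _ _ _ _ _ (measurable_shift_tuple t) lam
  setT (EFin \o gaussian_pdf m S))//.
  have shiftE A : measurable A -> lam (shift_tuple t @^-1` A) = lam A.
    by move=> mA; rewrite lamE lebesgueRn_shift.
  apply: eq_measure_integral; first exact: measurable_shift_tuple.
  by move=> ? A mA _; exact: shiftE.
  by apply/measurable_EFinP; exact: measurable_gaussian_pdf.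
by move=> y _; rewrite lee_fin; exact: gaussian_pdf_ge0.
Qed.

(** Evaluating [gaussian_mgf] at [e *: u] gives the one-variable generating function of the
    projection on [u]. *)
Lemma gaussian_linear_moments P m S u : is_gaussian P m S ->
  has_mean P (fun x => (u^T *m (colv x - m)) 0 0) 0 /\
  has_mean P (fun x => (u^T *m (colv x - m)) 0 0 ^+ 2) ((u^T *m S *m u) 0 0).
Proof.
move=> Pg; apply: moments_of_mgf => [|e].
  under eq_fun do rewrite mulmx_colE.
  apply: measurable_sum => i; apply: measurable_funM => //.
  exact: measurable_colv.
apply: has_mean_eq (gaussian_mgf (e *: u) Pg) _ _ => [x|]; congr expR.
  by rewrite [(e *: u)^T]linearZ/= -scalemxAl mxE.
by rewrite [(e *: u)^T]linearZ/= -!scalemxAl -scalemxAr !mxE; ring.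
Qed.

Lemma gaussian_mean P m S i : is_gaussian P m S ->
  has_mean P (fun x => tnth x i - m i 0) 0.
Proof.
move=> Pg; apply: has_mean_eq (gaussian_linear_moments (delta_mx i 0) Pg).1 _ _ => // x /=.
by rewrite trmx_delta -rowE mxE colvE.
Qed.

(** Polarization of the second moments in the directions of the two basis vectors and of their
    sum. *)
Lemma gaussian_cov P m S i j : is_gaussian P m S ->
  has_mean P (fun x => (tnth x i - m i 0) * (tnth x j - m j 0)) (S i j).
Proof.
move=> Pg; have [[St _] _] := Pg.
have dE k (B : 'cV[R]_d) : ((delta_mx k 0 : 'cV[R]_d)^T *m B) 0 0 = B k 0.
  by rewrite trmx_delta -rowE mxE.
have dSE k l : ((delta_mx k 0 : 'cV[R]_d)^T *m S *m (delta_mx l 0 : 'cV[R]_d)) 0 0 = S k l.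
  by rewrite -mulmxA dE -colE mxE.
have mxD (A B : 'M[R]_1) : (A + B) 0 0 = A 0 0 + B 0 0 by rewrite mxE.
have Sji : S j i = S i j by rewrite -[in LHS]St mxE.
have [_ h1] := gaussian_linear_moments (delta_mx i 0) Pg.
have [_ h2] := gaussian_linear_moments (delta_mx j 0) Pg.
have [_ h12] := gaussian_linear_moments (delta_mx i 0 + delta_mx j 0) Pg.
apply: has_mean_eq (has_meanZ 2^-1 (has_meanB (has_meanB h12 h1) h2)) _ _ => [x/=|].
  by rewrite [(_ + _)^T]linearD/= mulmxDl mxE !dE !colvE; field.
by rewrite [(_ + _)^T]linearD/= !mulmxDl !mulmxDr !mxD !dSE Sji; field.
Qed.

Lemma gaussian_cov_shift P m S c i j : is_gaussian P m S ->
  has_mean P (fun x => (tnth x i - c i 0) * (tnth x j - c j 0))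
    (S i j + (m - c) i 0 * (m - c) j 0).
Proof.
move=> Pg.
apply: has_mean_eq (has_meanD (has_meanD (gaussian_cov i j Pg)
  (has_meanD (has_meanZ (m j 0 - c j 0) (gaussian_mean i Pg))
             (has_meanZ (m i 0 - c i 0) (gaussian_mean j Pg))))
  (has_mean_cst P ((m i 0 - c i 0) * (m j 0 - c j 0)))) _ _ => [x/=|]; first by ring.
by rewrite !mxE; ring.
Qed.

(** The trace of [M^T *m (S + (v - c) *m (v - c)^T)]: the mean of the quadratic form of [M] centred
    at [c], for a law with mean [v] and covariance [S]. *)
Definition mean_quad c M v S : R :=
  \sum_i \sum_j M i j * (S i j + (v - c) i 0 * (v - c) j 0).

Lemma gaussian_mean_quad P m S c M : is_gaussian P m S ->
  has_mean P (fun x => ((colv x - c)^T *m M *m (colv x - c)) 0 0)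
    (mean_quad c M m S).
Proof.
move=> Pg; apply: has_mean_eq (has_mean_sum _ (fun i => has_mean_sum _ (fun j =>
  has_meanZ (M i j) (gaussian_cov_shift c i j Pg)))) _ _ => // x /=.
by rewrite quadE; apply: eq_bigr => i _; apply: eq_bigr => j _; rewrite !colvE.
Qed.

(** Minus the cross-entropy of N(c, M) relative to a law with mean [v] and covariance [S]. *)
Definition mean_ln_pdf c M v S : R :=
  ln (gaussian_cst M) - mean_quad c (invmx M) v S / 2.

Lemma gaussian_mean_ln_pdf P Q m S c M : is_gaussian P m S -> is_gaussian Q c M ->
  has_mean P (fun x => ln (gaussian_pdf c M x)) (mean_ln_pdf c M m S).
Proof.
move=> Pg Qg; apply: has_mean_eq (has_meanB (has_mean_cst P (ln (gaussian_cst M)))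
  (has_meanZ 2^-1 (gaussian_mean_quad c (invmx M) Pg))) _ _ => [x/=|].
  by rewrite (ln_gaussian_pdf _ Qg); ring.
by rewrite /mean_ln_pdf; ring.
Qed.

(** The value stays a difference of mean log-densities instead of the log-determinant formula:
    entropies then cancel and mixtures can be averaged. *)
Lemma KL_gaussian P Q m S c M : is_gaussian P m S -> is_gaussian Q c M ->
  KL P Q = (mean_ln_pdf m S m S - mean_ln_pdf c M m S)%:E.
Proof.
move=> Pg Qg; have [lam lamE] := @lebesgueRn_sigma_finite R d.
have [mf f0 PE] := is_gaussian_density lamE Pg.
have Qd := is_gaussian_density lamE Qg; have [mg g0 QE] := Qd.
have f_gt0 x := gaussian_pdf_gt0 x Pg; have g_gt0 x := gaussian_pdf_gt0 x Qg.
have lnfg := has_meanB (gaussian_mean_ln_pdf Pg Pg) (gaussian_mean_ln_pdf Pg Qg).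
(* The quotient of the densities, written as an exponential so that its sign, logarithm and
   measurability are immediate. *)
pose w x := expR (ln (gaussian_pdf m S x) - ln (gaussian_pdf c M x)).
have wE x : w x * gaussian_pdf c M x = gaussian_pdf m S x.
  by rewrite /w expRD expRN !lnK ?posrE// divfK ?gt_eqF.
apply: (@KL_density _ _ _ _ _ w); last first.
  by apply: has_mean_eq lnfg _ _ => // x; rewrite /w expRK.
have mw : measurable_fun setT w.
  by apply: measurableT_comp => //; exact: has_mean_measurable lnfg.
split => // [x|A mA]; first exact: expR_ge0.
rewrite PE// integral_mkcond [RHS]integral_mkcond.
transitivity (\int[lam]_x (\1_A x * w x * gaussian_pdf c M x)%:E)%E.
  apply: eq_integral => x _; rewrite -mulrA wE patchE indicE.
  by case: ifPn => xA; rewrite ?(mem_set xA) ?mul1r ?mul0r.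
have mAw : measurable_fun setT (fun x => \1_A x * w x) by exact: measurable_funM.
rewrite -(ge0_integral_density Qd mAw)// => [|x]; last by rewrite mulr_ge0 ?expR_ge0.
apply: eq_integral => x _; rewrite patchE indicE.
by case: ifPn => xA; rewrite ?mul1r ?mul0r.
Qed.

(** A Gaussian log-density is quadratic, so its mean sees only two moments; [m'] and [S'] are those
    of the mixture, by the law of total covariance. *)
Lemma mean_ln_pdf_mixture (I : finType) (w : I -> R) (v : I -> 'cV[R]_d)
    (Q : I -> 'M[R]_d) c M :
  \sum_i w i = 1 ->
  let m' := \sum_i w i *: v i in
  let S' := \sum_i w i *: (Q i + (v i - m') *m (v i - m')^T) in
  \sum_i w i * mean_ln_pdf c M (v i) (Q i) = mean_ln_pdf c M m' S'.
Proof.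
move=> w1 m' S'.
have mE j : m' j 0 = \sum_i w i * v i j 0.
  by rewrite summxE; apply: eq_bigr => i _; rewrite mxE.
have covE j k : \sum_i w i * (Q i j k + (v i - c) j 0 * (v i - c) k 0) =
    S' j k + (m' - c) j 0 * (m' - c) k 0.
  rewrite summxE.
  have -> : (m' - c) j 0 * (m' - c) k 0 = \sum_i w i * ((m' - c) j 0 * (m' - c) k 0).
    by rewrite -mulr_suml w1 mul1r.
  have c1 l : \sum_i w i * (v i l 0 - m' l 0) = 0.
    under eq_bigr do rewrite mulrBr.
    by rewrite sumrB -mE -mulr_suml w1 mul1r subrr.
  (* Weighted deviations from [m'] cancel. Adding this zero to the right-hand side makes the
     identity hold term by term. *)
  have cross : \sum_i w i * (v i j 0 - m' j 0) * (m' k 0 - c k 0) +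
      \sum_i w i * (v i k 0 - m' k 0) * (m' j 0 - c j 0) = 0.
    have cE l r : \sum_i w i * (v i l 0 - m' l 0) * r = 0.
      by rewrite -mulr_suml c1 mul0r.
    by rewrite !cE addr0.
  rewrite -[RHS]addr0 -[X in _ = _ + X]cross -!big_split/=.
  apply: eq_bigr => i _.
  by rewrite !mxE big_ord1 !mxE; ring.
rewrite /mean_ln_pdf; under eq_bigr do rewrite mulrBr.
rewrite sumrB -mulr_suml w1 mul1r; congr (_ - _).
under eq_bigr do rewrite mulrA.
rewrite -mulr_suml; congr (_ / _); rewrite /mean_quad.
under eq_bigr do rewrite mulr_sumr.
rewrite exchange_big/=; apply: eq_bigr => j _.
under eq_bigr do rewrite mulr_sumr.
rewrite exchange_big/=; apply: eq_bigr => k _.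
rewrite -covE mulr_sumr; apply: eq_bigr => i _.
by rewrite mulrCA.
Qed.

End gaussian.

(** * The transport functional and the descent *)

Section transport.
Context {R : realType} {d : nat}.
Local Notation E := (d.-tuple R).
Implicit Types (p q mu nu : probability E R).
Local Open Scope ereal_scope.

Lemma W2sq_ge0 p q : 0 <= W2sq p q.
Proof.
apply/ereal_infP => _ [g _ <-]; apply: integral_ge0 => z _.
by rewrite lee_fin sumr_ge0// => i _; exact: sqr_ge0.
Qed.

Lemma gaussian_sqr_mean p m S i : is_gaussian p m S ->
  exists r, has_mean p (fun x => tnth x i ^+ 2)%R r.
Proof.
move=> pg; have h := gaussian_cov_shift 0 i i pg.
by eexists; apply: has_mean_eq h _ erefl => x /=; rewrite !mxE subr0 expr2.
Qed.

(** The product coupling has finite cost, since the squared distance is at most twice the sum of the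
    squared norms. *)
Lemma W2sq_gaussian_lty p q m S c M : is_gaussian p m S -> is_gaussian q c M ->
  W2sq p q < +oo.
Proof.
move=> pg qg.
have [g [g1 g2]] : exists g : probability (E * E)%type R, coupling p q g.
  exists (p \x q)%E; split => A mA; rewrite /pushforward.
    rewrite (_ : _ @^-1` _ = A `*` setT); last by apply/seteqP; split => x //= [].
    transitivity (p A * q setT); first exact: product_measure1E.
    by rewrite probability_setT mule1.
  rewrite (_ : _ @^-1` _ = setT `*` A); last by apply/seteqP; split => x //= [].
  transitivity (p setT * q A); first exact: product_measure1E.
  by rewrite probability_setT mul1e.
have coord (r : probability E R) (f : E * E -> E) i :
    measurable_fun setT f -> meas_eq (pushforward g f) r ->
    (exists k, has_mean r (fun x => tnth x i ^+ 2)%R k) ->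
    exists k, has_mean g (fun z => tnth (f z) i ^+ 2)%R k.
  move=> mf gf [k [ik rk]]; exists k.
  have mt : measurable_fun setT (fun x : E => tnth x i ^+ 2)%R.
    by apply: measurable_funX; exact: measurable_tnth.
  apply: ge0_has_mean => [|z|]; [|exact: sqr_ge0|].
    exact: (measurableT_comp mt mf).
  rewrite -rk -(eq_measure_integral _ (fun A mA _ => gf A mA)).
  rewrite (ge0_integral_pushforward mf)//; first exact/measurable_EFinP.
  by move=> x _; rewrite lee_fin sqr_ge0.
have fin : exists k, has_mean g (fun z => sqdist z.1 z.2) k.
  have h1 i := coord p fst i measurable_fst g1 (gaussian_sqr_mean i pg).
  have h2 i := coord q snd i measurable_snd g2 (gaussian_sqr_mean i qg).
  have B := has_mean_sum (index_enum 'I_d) (fun i =>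
    has_meanZ 2 (has_meanD (projT2 (cid (h1 i))) (projT2 (cid (h2 i))))).
  apply: has_mean_dominated B _.
    apply: measurable_sum => i; apply: measurable_funX; apply: measurable_funB.
      exact: (measurableT_comp (measurable_tnth i) measurable_fst).
    exact: (measurableT_comp (measurable_tnth i) measurable_snd).
  move=> z /=; rewrite ger0_norm; last by rewrite sumr_ge0// => i _; exact: sqr_ge0.
  apply: ler_sum => i _; have := sqr_ge0 (tnth z.1 i + tnth z.2 i)%R.
  rewrite sqrrD sqrrB; lra.
have [k [_ gk]] := fin.
apply: le_lt_trans (_ : k%:E < _); last exact: ltry.
by apply: ereal_inf_lbound; exists g.
Qed.

Context (tau0 tau1 : R).
Hypotheses (tau0_gt0 : (0 < tau0)%R) (tau1_gt0 : (0 < tau1)%R).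

Lemma A_objective_ge0 mu nu p q : 0 <= A_objective tau0 tau1 mu nu p q.
Proof.
by rewrite !adde_ge0 ?W2sq_ge0// mule_ge0 ?KL_ge0// lee_fin ltW.
Qed.

Lemma A_value_ge0 mu nu : 0 <= A_value tau0 tau1 mu nu.
Proof. by apply/ereal_infP => _ [pq _ <-]; exact: A_objective_ge0. Qed.

Lemma A_value_le mu nu p q : A_value tau0 tau1 mu nu <= A_objective tau0 tau1 mu nu p q.
Proof. by apply: ereal_inf_lbound; exists (p, q). Qed.

(** The competitor [(mu, nu)] has zero entropy terms and finite transport cost. *)
Lemma A_value_gaussian mu nu m S c M : is_gaussian mu m S -> is_gaussian nu c M ->
  A_value tau0 tau1 mu nu \is a fin_num.
Proof.
move=> mug nug; rewrite ge0_fin_numE ?A_value_ge0//.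
apply: le_lt_trans (A_value_le mu nu mu nu) _.
rewrite /A_objective (KL_gaussian mug mug) (KL_gaussian nug nug) !subrr !mule0 !adde0.
exact: W2sq_gaussian_lty mug nug.
Qed.

Lemma A_value_meas_eqr mu nu nu' : meas_eq nu nu' ->
  A_value tau0 tau1 mu nu = A_value tau0 tau1 mu nu'.
Proof.
move=> nunu'; rewrite /A_value; congr (ereal_inf (image _ _)).
by apply/funext => pq; rewrite /A_objective (KL_meas_eqr _ nunu').
Qed.

(* The minimizer for [nu] is a competitor for [nu']. *)
Lemma A_value_descent mu nu nu' p q k k' :
  A_value tau0 tau1 mu nu \is a fin_num ->
  A_minimizer tau0 tau1 mu nu p q -> KL q nu = k%:E -> KL q nu' = k'%:E ->
  A_value tau0 tau1 mu nu' <= A_value tau0 tau1 mu nu + (tau1 * (k' - k))%:E.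
Proof.
move=> Afin; rewrite /A_minimizer => Amin qk qk'.
apply: le_trans (A_value_le mu nu' p q) _; rewrite -Amin /A_objective qk qk'.
rewrite -!addeA leeD2l// leeD2l// -!EFinM -EFinD lee_fin; lra.
Qed.

End transport.

(* Jensen's inequality, through the tangent line of [expR] at [t]. *)
Lemma expR_weighted_sum_ge (R : realType) (I : finType) (w x : I -> R) (t : R) :
  (forall i, 0 < w i) -> t * \sum_i w i <= \sum_i w i * x i ->
  (\sum_i w i) * expR t <= \sum_i w i * expR (x i).
Proof.
move=> w0 tx; pose W := \sum_i w i.
have tangent i : w i * (expR t * (1 + (x i - t))) <= w i * expR (x i).
  rewrite ler_pM2l//; have := ler_wpM2l (expR_ge0 t) (expR_ge1Dx (x i - t)).
  by rewrite -expRD subrKC.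
apply: (le_trans _ (ler_sum _ (fun i _ => tangent i))).
have -> : \sum_i w i * (expR t * (1 + (x i - t))) =
    W * expR t + expR t * (\sum_i w i * x i - t * W).
  rewrite /W mulr_suml mulr_sumr -sumrB mulr_sumr -big_split/=.
  by apply: eq_bigr => i _; ring.
by rewrite lerDl mulr_ge0 ?expR_ge0// subr_ge0.
Qed.

(** The scalar core: [w] stands for the old weights, [x] for the increments of the transport values,
    [k] for the entropy between the iterates. *)
Lemma partition_descent (R : realType) (I : finType) (tau0 tau1 k : R)
    (w x : I -> R) :
  0 < tau0 -> 0 < tau1 -> (forall i, 0 < w i) ->
  \sum_i w i * x i <= - (tau1 * k) * \sum_i w i ->
  0 < \sum_i w i ->
  tau1 * (\sum_i w i) `^ (theta tau0 tau1)^-1 * k <=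
  tau0 * ((\sum_i w i * expR (- (x i / (tau0 + tau1)))) `^ (theta tau0 tau1)^-1 -
          (\sum_i w i) `^ (theta tau0 tau1)^-1).
Proof.
move=> tau0_gt0 tau1_gt0 w_gt0; set Z := \sum_i w i => wx Z_gt0.
set b := Z `^ _; set b' := _ `^ _.
have s_gt0 : 0 < tau0 + tau1 by rewrite addr_gt0.
have theta_gt0 : 0 < theta tau0 tau1 by rewrite divr_gt0.
have b_gt0 : 0 < b by rewrite powR_gt0.
have Z'_ge : Z * expR (tau1 * k / (tau0 + tau1)) <=
    \sum_i w i * expR (- (x i / (tau0 + tau1))).
  apply: expR_weighted_sum_ge => //.
  have -> : \sum_i w i * - (x i / (tau0 + tau1)) =
      (- \sum_i w i * x i) / (tau0 + tau1).
    by rewrite -sumrN mulr_suml; apply: eq_bigr => i _; rewrite mulrN mulrA mulNr.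
  by rewrite mulrAC ler_pM2r ?invr_gt0// lerNr -mulNr.
have b'_ge : b * (1 + tau1 * k / tau0) <= b'.
  apply: le_trans (_ : (Z * expR (tau1 * k / (tau0 + tau1))) `^ (theta tau0 tau1)^-1 <= _).
    rewrite powRM ?expR_ge0 ?(ltW Z_gt0)// ler_pM2l//.
    rewrite /powR gt_eqF ?expR_gt0// expRK.
    (* The exponents are equal: [1 / theta = (tau0 + tau1) / tau0] turns [tau1 * k / (tau0 + tau1)]
       into [tau1 * k / tau0]. *)
    apply: le_trans (expR_ge1Dx _) _; rewrite ler_expR le_eqVlt; apply/orP; left.
    by apply/eqP; rewrite /theta; field; rewrite !gt_eqF.
  rewrite ge0_ler_powR ?nnegrE ?invr_ge0 ?(ltW theta_gt0)//.
    by rewrite mulr_ge0 ?expR_ge0 ?ltW.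
  by apply: le_trans Z'_ge; rewrite mulr_ge0 ?expR_ge0 ?ltW.
have -> : tau1 * b * k = tau0 * (b * (1 + tau1 * k / tau0) - b).
  by field; rewrite gt_eqF.
by rewrite ler_pM2l// lerD2r.
Qed.

Lemma weightE (R : realType) (d n : nat) (tau0 tau1 : R) (lambda a : 'I_n -> R)
    (mu : 'I_n -> probability (d.-tuple R) R) nu i :
  A_value tau0 tau1 (mu i) nu \is a fin_num ->
  weight tau0 tau1 lambda a mu nu i = lambda i * a i `^ theta tau0 tau1 *
    expR (- (fine (A_value tau0 tau1 (mu i) nu) / (tau0 + tau1))).
Proof. by move=> Afin; rewrite /weight -{1}(fineK Afin). Qed.

Unset Implicit Arguments.

Theorem theorem5p4 (R : realType) (d n : nat) (tau0 tau1 : R)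
    (lambda a : 'I_n -> R) (m : 'I_n -> 'cV[R]_d) (Sigma : 'I_n -> 'M[R]_d)
    (mu : 'I_n -> probability (d.-tuple R) R)
    (nu nu' : probability (d.-tuple R) R) :
  0 < tau0 -> 0 < tau1 -> (1 <= n)%N ->
  (forall i, 0 < lambda i) -> \sum_i lambda i = 1 ->
  (forall i, 0 < a i) ->
  (forall i, is_gaussian (mu i) (m i) (Sigma i)) ->
  nondeg_gaussian nu ->
  moment_update tau0 tau1 lambda a mu nu nu' ->
  let F := Phi tau0 tau1 lambda a mu in
  let b := Zpart tau0 tau1 lambda a mu nu `^ (theta tau0 tau1)^-1 in
  [/\ ((F nu - F nu')%:E >= (tau1 * b)%:E * KL nu' nu)%E,
      ((tau1 * b)%:E * KL nu' nu >= 0)%E,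
      ~ meas_eq nu' nu -> F nu' < F nu
    & F nu' = F nu <-> meas_eq nu' nu].
Proof.
move=> tau0_gt0 tau1_gt0 n_gt0 lambda_gt0 _ a_gt0 mug [c [M nug]].
move=> [p [q [v [Q [qmin [qg nu'gauss]]]]]] F b.
pose om := omega tau0 tau1 lambda a mu nu.
pose m' := \sum_i om i *: v i.
pose S' := \sum_i om i *: (Q i + (v i - m') *m (v i - m')^T).
have nu'g : is_gaussian nu' m' S' by exact: nu'gauss.
have Anu i := A_value_gaussian tau0_gt0 tau1_gt0 (mug i) nug.
have Anu' i := A_value_gaussian tau0_gt0 tau1_gt0 (mug i) nu'g.
pose w := weight tau0 tau1 lambda a mu nu.
pose x i := fine (A_value tau0 tau1 (mu i) nu') - fine (A_value tau0 tau1 (mu i) nu).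
have w_gt0 i : 0 < w i.
  by rewrite /w weightE// mulr_gt0 ?expR_gt0// mulr_gt0// powR_gt0.
have Z_gt0 : 0 < \sum_i w i.
  rewrite (bigD1 (Ordinal n_gt0))//= ltr_pwDl//.
  by apply: sumr_ge0 => i _; exact: ltW.
have om_sum1 : \sum_i om i = 1.
  by rewrite /om /omega -mulr_suml mulfV ?gt_eqF.
have [k KLk] : exists k, KL nu' nu = k%:E by rewrite (KL_gaussian nu'g nug); eexists.
have k_ge0 : 0 <= k by have := KL_ge0 nu' nu; rewrite KLk lee_fin.
have sum_x : \sum_i w i * x i <= - (tau1 * k) * \sum_i w i.
  (* [L i] is [KL (q i) nu' - KL (q i) nu], in which the entropy of [q i] cancels. *)
  pose L i := mean_ln_pdf c M (v i) (Q i) - mean_ln_pdf m' S' (v i) (Q i).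
  have xL i : x i <= tau1 * L i.
    have := A_value_descent (Anu i) (qmin i) (KL_gaussian (qg i) nug)
      (KL_gaussian (qg i) nu'g).
    rewrite -(fineK (Anu i)) -(fineK (Anu' i)) -EFinD lee_fin -lerBlDl.
    by have -> (y z t : R) : y - t - (y - z) = z - t by ring.
  (* Averaging replaces the moments of each [q i] by those of [nu'], which leaves minus the entropy
     of [nu'] relative to [nu]. *)
  have omL : \sum_i om i * L i = - k.
    rewrite /L; under eq_bigr do rewrite mulrBr.
    rewrite sumrB !mean_ln_pdf_mixture// -/m' -/S' -opprB; congr (- _).
    by apply: EFin_inj; rewrite -KLk (KL_gaussian nu'g nug).
  have wL : \sum_i w i * L i = - k * \sum_i w i.
    rewrite -omL mulr_suml; apply: eq_bigr => i _.
    by rewrite [RHS]mulrAC /om /omega -[Zpart _ _ _ _ _ _]/(\sum_i w i) divfK ?gt_eqF.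
  rewrite -mulrN -mulrA -wL mulr_sumr; apply: ler_sum => i _.
  by rewrite mulrCA ler_pM2l.
have weight'E i : weight tau0 tau1 lambda a mu nu' i =
    w i * expR (- (x i / (tau0 + tau1))).
  rewrite /w !weightE// -[RHS]mulrA -expRD; congr (_ * expR _).
  by rewrite /x mulrBl opprB addKr.
have descent : tau1 * b * k <= F nu - F nu'.
  have -> : F nu - F nu' =
      tau0 * (Zpart tau0 tau1 lambda a mu nu' `^ (theta tau0 tau1)^-1 - b).
    by rewrite /F /Phi -/b; have -> (t y z z' : R) :
      t * (y - z) - t * (y - z') = t * (z' - z) by ring.
  rewrite {1}/Zpart; under eq_bigr do rewrite weight'E.
  exact: partition_descent.
have tb_gt0 : 0 < tau1 * b by apply: mulr_gt0 => //; exact: powR_gt0.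
(* Agreement on measurable sets is weaker than equality of [nu'] and [nu], so the invariance of
   [A_value] has to be invoked. *)
have KLs : meas_eq nu' nu -> F nu' = F nu.
  move=> nunu'; rewrite /F /Phi.
  suff -> : Zpart tau0 tau1 lambda a mu nu' = Zpart tau0 tau1 lambda a mu nu by [].
  by apply: eq_bigr => i _; rewrite /weight (A_value_meas_eqr _ _ _ nunu').
have strict : ~ meas_eq nu' nu -> F nu' < F nu.
  move=> nunu'; rewrite -subr_gt0; apply: lt_le_trans descent.
  rewrite (pmulr_rgt0 _ tb_gt0) lt_neqAle k_ge0 andbT eq_sym; apply/eqP => k0.
  by apply: nunu'; apply: KL_eq0; rewrite KLk k0.
clearbody F b; split.
- by rewrite KLk -EFinM lee_fin.
- by rewrite KLk -EFinM lee_fin (pmulr_rge0 _ tb_gt0).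
- exact: strict.
- split => [FF|]; last exact: KLs.
  by apply: contrapT => /strict; rewrite FF ltxx.
Qed.
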